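(* Let $i,j,k,m$ be positive integers. The property $P(i,j,k,m-1)$ holds if and only if there exists a Boolean algebra $\mathbb{B}$ such that $\mathfrak{r}_{i,k}(\mathbb{B}) > \mathfrak{r}_{j,m}(\mathbb{B})$.
   Context: Trees: a tree is a nonempty set of finite sequences of natural numbers closed under initial segments, ordered by the initial-segment relation. $\mu(T)$ denotes the set of maximal elements of a tree $T$. A tree $T$ is $k$-branching if every $\sigma\in T\setminus\mu(T)$ has exactly $k$ immediate successors in $T$. A subtree of $T$ is a subset of $T$ which is itself a tree. For integers $i,j,k,m$, the property $P(i,j,k,m)$ means: for every finite $i$-branching tree $T$ and every colouring $\chi:\mu(T)\to j=\{0,\dots,j-1\}$ there is a $k$-branching subtree $T'\subseteq T$ with $\mu(T')\subseteq\mu(T)$ such that $\chi\restriction\mu(T')$ takes at most $m$ values. Reaping: for a Boolean algebra $\mathbb{B}$ and integer $n$, an $n$-partition of $\mathbb{B}$ is a set $R$ of $n$ elements of $\mathbb{B}$ with $\bigvee R=1$ and $a\wedge b=0$ for distinct $a,b\in R$. A set $A\subseteq\mathbb{B}$ is $(n,k)$-reaped by $R$ if $R$ is an $n$-partition and $|\{b\in R: b\wedge a\neq 0\}|\ge k$ for every $a\in A$. $\mathfrak{r}_{n,k}(\mathbb{B})$ is the least cardinality of a subset of $\mathbb{B}\setminus\{0\}$ which is not $(n,k)$-reaped by any $n$-partition of $\mathbb{B}$.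
   Formalization: The Boolean algebra is also required to have an i-partition and a j-partition: as worded the claim fails for i=k=m=2, j=3 and the two-element algebra, where r_{3,2}=0 < r_{2,2}=1 but P(2,3,2,1) is false. A reaping number is infinite when every subset is reaped. *)

(* Defs.v *)
From mathcomp Require Import all_boot all_order.
From mathcomp Require Import finmap.
From mathcomp Require Import boolp classical_sets functions cardinality.

Set Implicit Arguments.
Unset Strict Implicit.
Unset Printing Implicit Defensive.

Local Open Scope classical_set_scope.
Local Open Scope card_scope.
Local Open Scope fset_scope.

Definition is_tree (T : set (seq nat)) : Prop :=
  T !=set0 /\ forall s t, T t -> prefix s t -> T s.

Definition mu (T : set (seq nat)) : set (seq nat) :=
  [set s | T s /\ forall t, T t -> prefix s t -> t = s].

Definition immediate_successors (T : set (seq nat)) (s : seq nat) :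
    set (seq nat) :=
  [set t | T t /\ exists x, t = rcons s x].

Definition branching (k : nat) (T : set (seq nat)) : Prop :=
  forall s, T s -> ~ mu T s -> immediate_successors T s #= `I_k.

(* Only the values of [chi] on [mu T] are used, so [chi] stands for an
   arbitrary function from [mu T] to {0, ..., j-1}. *)
Definition tree_property (i j k m : nat) : Prop :=
  forall T : set (seq nat), is_tree T -> finite_set T -> branching i T ->
  forall chi : seq nat -> nat, (forall s, mu T s -> (chi s < j)%N) ->
  exists T' : set (seq nat),
    [/\ is_tree T', (T' `<=` T)%classic, branching k T',
        (mu T' `<=` mu T)%classic & chi @` mu T' #<= `I_m].

Section Reaping.
Context {d : Order.disp_t} {B : ctbDistrLatticeType d}.

(* As a set of n distinct elements, an n-partition may contain \bot, but only
   once; a finite algebra therefore has no n-partition for large n. *)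
Definition is_partition (n : nat) (R : {fset B}) : Prop :=
  [/\ #|` R| = n, (\join_(b <- R) b)%O = \top%O
    & forall a b, a \in R -> b \in R -> a != b -> Order.meet a b = \bot%O].

Definition reaped_by (n k : nat) (R : {fset B}) (A : set B) : Prop :=
  is_partition n R /\
  forall a, A a -> (k <= #|` [fset b in R | Order.meet b a != \bot%O]|)%N.

Definition unreaped (n k : nat) (A : set B) : Prop :=
  ~ A \bot%O /\ forall R : {fset B}, ~ reaped_by n k R A.

(* The reaping number r_{n,k}(B) is represented by a set of that cardinality:
   [Some A] means that it is the cardinality of [A], and [None] that it is
   infinity, the minimum of the empty family (as always happens for k = 1 when
   there is an n-partition). *)
Definition is_reaping_number (n k : nat) (c : option (set B)) : Prop :=
  match c with
  | Some A => unreaped n k A /\ forall C : set B, unreaped n k C -> A #<= C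
  | None => forall C : set B, ~ unreaped n k C
  end.

Definition cardinal_lt (c c' : option (set B)) : Prop :=
  match c, c' with
  | Some A, Some C => A #<= C /\ ~ (C #<= A)
  | Some _, None => True
  | None, _ => False
  end.

End Reaping.

Definition has_partition d (B : ctbDistrLatticeType d) (n : nat) : Prop :=
  exists R : {fset B}, is_partition n R.

Definition reaping_number_lt d (B : ctbDistrLatticeType d)
    (n k n' k' : nat) : Prop :=
  exists c c' : option (set B),
    [/\ is_reaping_number n k c, is_reaping_number n' k' c'
      & cardinal_lt c c'].

(* Main.v *)
(** If r_{j,m}(B) < r_{i,k}(B), let A be a set of least size that is not
    (j,m)-reaped. Given a coloured i-branching tree, attach an element of B to
    each node, starting with 1 at the root and splitting each element by a
    partition that (i,k)-reaps the trace of A on it. Joining the leaves of each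
    colour gives a j-partition, so some a in A meets fewer than m colours, and
    the nodes that meet a contain the required k-branching subtree.

    Conversely, P(i,j,k,m-1) yields an algebra in which countable sets are
    (i,k)-reaped but some countable set is not (j,m)-reaped. It consists of sets
    of branches f : omega_1 -> i. The reaping partitions are the sets
    {f | f(b) = x} for x < i. The unreaped set consists of the slices of countably
    many "k-branching" families of branches: in each of them f(b) ranges over a
    k-set that depends on a finite approximation of b and of f below b. Since
    there are at most continuum many coordinates, countably many codes suffice to
    realise all k-branching trees on all finite sets of coordinates, and
    P(i,j,k,m-1) provides a tree on which a given j-partition has fewer than m
    colours. *)

Require Import Defs.
From mathcomp Require Import all_boot all_order.
From HB Require Import structures.
From mathcomp Require Import perm finmap.
From mathcomp Require Import boolp classical_sets functions cardinality wochoice.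

Set Implicit Arguments.
Unset Strict Implicit.
Unset Printing Implicit Defensive.

Import Order.Theory.


(** * Partitions as indexed families *)

Section IndexedPartition.
Context {d : Order.disp_t} {B : ctbDistrLatticeType d}.
Local Open Scope order_scope.

(** Several pieces may be [\bot], as happens when some colours occur at no leaf. Covering is
    expressed by meets, so that no join has to be computed. *)
Definition indexed_partition (n : nat) (c : 'I_n -> B) : Prop :=
  (forall x y, x != y -> c x `&` c y = \bot) /\
  (forall a, a != \bot -> exists x, c x `&` a != \bot).

Definition hits (n : nat) (c : 'I_n -> B) (a : B) : nat :=
  #|[set x | c x `&` a != \bot]|.

Lemma joins_meet_neq0 (I : eqType) (s : seq I) (P : pred I) (F : I -> B) a :
  ((\join_(x <- s | P x) F x) `&` a != \bot) =
  has (fun x => P x && (F x `&` a != \bot)) s.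
Proof.
elim: s => [|x s IHs] /=; first by rewrite big_nil meet0x eqxx.
rewrite big_cons; case: (P x) => //=.
by rewrite meetUl join_eq0 negb_and IHs.
Qed.

Lemma eq_topP (b : B) :
  (forall a, a != \bot -> b `&` a != \bot) -> b = \top.
Proof.
move=> bP; rewrite -[b]complK; have [->|/bP] := eqVneq (~` b) \bot.
  by rewrite compl0.
by rewrite meetxC eqxx.
Qed.

Lemma indexed_of_partition n (R : {fset B}) : is_partition n R ->
  exists c : 'I_n -> B,
    [/\ injective c, R = [fset c x | x in 'I_n]%fset & indexed_partition c].
Proof.
move=> [cardR joinR disjR]; pose c (x : 'I_n) := nth \bot (enum_fset R) x.
have sR : size (enum_fset R) = n by rewrite -cardR cardfE.
have injc : injective c.
  move=> x y /eqP; rewrite nth_uniq ?fset_uniq ?sR //.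
  by move=> /eqP; exact: val_inj.
have cR x : c x \in R by rewrite mem_nth ?sR.
have RE : R = [fset c x | x in 'I_n]%fset.
  apply/fsetP => b; apply/idP/imfsetP => [bR|[x _ ->]] //.
  have ltn : (index b (enum_fset R) < n)%N by rewrite -sR index_mem.
  by exists (Ordinal ltn) => //; rewrite /c nth_index.
exists c; split=> //; split=> [x y xy|a a0].
  by apply: disjR => //; apply: contraNneq xy => /injc ->.
have : (\join_(b <- R) b) `&` a != \bot by rewrite joinR meet1x.
rewrite joins_meet_neq0 => /hasP[b]; rewrite {1}RE => /imfsetP[x _ ->] /= ca.
by exists x.
Qed.

Lemma partition_of_indexed n (c : 'I_n -> B) :
  injective c -> indexed_partition c ->
  is_partition n [fset c x | x in 'I_n]%fset.
Proof.
move=> injc [disjc coverc]; split.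
- by rewrite card_imfset //= -cardE card_ord.
- apply: eq_topP => a /coverc[x cxa]; rewrite joins_meet_neq0.
  by apply/hasP; exists (c x) => //; apply/imfsetP; exists x.
- move=> _ _ /imfsetP[x _ ->] /imfsetP[y _ ->] /= cxy; apply: disjc.
  by apply: contraNneq cxy => ->.
Qed.

Lemma card_hits n (c : 'I_n -> B) a : injective c ->
  #|` [fset b in [fset c x | x in 'I_n] | (b `&` a != \bot)%O]%fset| = hits c a.
Proof.
move=> injc.
have -> : [fset b in [fset c x | x in 'I_n] | (b `&` a != \bot)%O]%fset =
          [fset c x | x in [set x | (c x `&` a)%O != \bot]]%fset.
  apply/fsetP => b; rewrite !inE /=; apply/andP/imfsetP => /=.
    by move=> [/imfsetP[x _ ->] xa]; exists x; rewrite ?inE.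
  move=> [x]; rewrite !inE => xa ->.
  by split=> //; apply/imfsetP; exists x.
by rewrite card_imfset //= -cardE.
Qed.

Lemma reaped_byP n k (A : set B) :
  (exists R, reaped_by n k R A) <->
  exists c : 'I_n -> B, [/\ injective c, indexed_partition c
    & forall a, A a -> (k <= hits c a)%N].
Proof.
split=> [[R [/indexed_of_partition[c [injc -> pc]] RA]]|[c [injc pc cA]]].
  by exists c; split=> // a /RA; rewrite card_hits.
exists [fset c x | x in 'I_n]%fset; split; first exact: partition_of_indexed.
by move=> a /cA; rewrite card_hits.
Qed.

Lemma has_partitionP n :
  has_partition B n <->
  exists c : 'I_n -> B, injective c /\ indexed_partition c.
Proof.
split=> [[R /indexed_of_partition[c [? _ ?]]]|[c [? ?]]]; first by exists c.
by exists [fset c x | x in 'I_n]%fset; apply: partition_of_indexed.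
Qed.

(* With two empty pieces, at most [n - 2] pieces are nonzero, so by the
   pigeonhole principle one of them meets two pieces of a genuine
   [n]-partition and can be split into two nonzero parts. *)
Lemma split_partition n (c : 'I_n -> B) (l l' : 'I_n) :
  has_partition B n -> indexed_partition c ->
  l != l' -> c l = \bot -> c l' = \bot ->
  exists c' : 'I_n -> B,
    [/\ indexed_partition c', forall a, (hits c a <= hits c' a)%N
      & (#|[set x | c' x == \bot]| < #|[set x | c x == \bot]|)%N].
Proof.
move=> /has_partitionP[q [injq [disjq coverq]]] [disjc coverc] ll' cl cl'.
have [r [y [y' [yy' ry ry']]]] :
    exists r y y', [/\ y != y', c r `&` q y != \bot & c r `&` q y' != \bot].
  apply: contrapT => nosplit.
  pose Q := [set y | q y != \bot].
  have /choice[f fP] y : exists r, y \in Q -> c r `&` q y != \bot.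
    have [yQ|] := boolP (y \in Q); last by exists l.
    by rewrite inE in yQ; have [r cr] := coverc _ yQ; exists r.
  have injf : {in Q &, injective f}.
    move=> y y' yQ y'Q fyy'; apply/eqP/negP => /negP yy'; apply: nosplit.
    by exists (f y), y, y'; split=> //; [exact: fP|rewrite fyy'; exact: fP].
  have leQ : (#|Q| <= #|~: [set l; l']|)%N.
    rewrite -(card_in_imset injf).
    apply/subset_leq_card/fintype.subsetP => _ /imsetP[y yQ ->].
    rewrite !inE negb_or.
    by apply/andP; split; apply: contraTneq (fP _ yQ) => ->;
      rewrite ?cl ?cl' meet0x eqxx.
  have leQC : (#|~: Q| <= 1)%N.
    apply/card_le1_eqP => y y'; rewrite !inE !negbK => /eqP qy /eqP qy'.
    by apply: injq; rewrite qy qy'.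
  have := leq_add leQ leQC; rewrite cardsC -(cardsC [set l; l']) cards2 ll'.
  by rewrite addnC leq_add2l.
(* The slot [r] keeps the part of [c r] inside [q y]; the empty slot [l] takes the rest, which is
   nonzero because [c r] also meets [q y']. *)
pose c' x := if x == r then c r `&` q y else if x == l then c r `\` q y else c x.
have lr : l != r by apply: contraNneq ry => <-; rewrite cl meet0x.
have c'l : c' l = c r `\` q y by rewrite /c' (negbTE lr) eqxx.
have c'r : c' r = c r `&` q y by rewrite /c' eqxx.
have c'N x : x != r -> x != l -> c' x = c x.
  by rewrite /c' => /negbTE -> /negbTE ->.
have c'rl : c' r `&` c' l = \bot.
  by rewrite c'r c'l meetC diffE -meetA [_ `&` (c r `&` _)]meetCA meetCx ?meetx0.
have joinrl : c' r `|` c' l = c r by rewrite c'r c'l joinIB.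
have [c'r0 c'l0] : c' r != \bot /\ c' l != \bot.
  rewrite c'r c'l; split=> //; apply: contraNneq ry' => /eqP.
  by rewrite diff_eq0 => le; rewrite -lex0 -(disjq _ _ yy') leI2.
have disj_r x : x != r -> x != l -> c' x `&` c' r = \bot /\ c' x `&` c' l = \bot.
  move=> xr xl; have := disjc _ _ xr.
  rewrite -joinrl meetUr -c'N // => /eqP.
  by rewrite join_eq0 => /andP[/eqP -> /eqP ->].
exists c'; split; first split.
- move=> x z xz.
  have [xr|xr] := eqVneq x r.
    have [->|zl] := eqVneq z l; first by rewrite xr.
    by rewrite xr meetC; apply: (disj_r z _ zl).1; rewrite -xr eq_sym.
  have [xl|xl] := eqVneq x l.
    have [->|zr] := eqVneq z r; first by rewrite xl meetC.
    by rewrite xl meetC; apply: (disj_r z zr _).2; rewrite -xl eq_sym.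
  have [->|zr] := eqVneq z r; first exact: (disj_r x xr xl).1.
  have [->|zl] := eqVneq z l; first exact: (disj_r x xr xl).2.
  by rewrite !c'N // disjc.
- move=> a /coverc[x]; have [->|xr] := eqVneq x r.
    rewrite -joinrl meetUl join_eq0 negb_and => /orP[|] ?; first by exists r.
    by exists l.
  have [->|xl] := eqVneq x l; first by rewrite cl meet0x eqxx.
  by rewrite -c'N //; exists x.
- move=> a; rewrite /hits; set S := [set x | _]; set S' := [set x | _].
  rewrite (cardsD1 r S) (cardsD1 r S') (cardsD1 l (S' :\ r)) addnA leq_add //.
    rewrite !inE lr /= -joinrl meetUl join_eq0 negb_and.
    by case: (_ != _); case: (_ != _).
  apply/subset_leq_card/fintype.subsetP => x; rewrite !inE => /andP[xr].
  have [->|xl] := eqVneq x l; first by rewrite cl meet0x eqxx.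
  by rewrite c'N // xr.
- apply/proper_card/properP; split; last first.
    by exists l; rewrite !inE ?cl ?eqxx // (negbTE c'l0).
  apply/fintype.subsetP => x; rewrite !inE.
  have [->|xr] := eqVneq x r; first by rewrite (negbTE c'r0).
  have [->|xl] := eqVneq x l; first by rewrite (negbTE c'l0).
  by rewrite c'N.
Qed.

(** Disjoint pieces that coincide are [\bot], so a family that is not injective has two empty slots,
    and [split_partition] lowers the number of empty slots without losing hits. *)
Lemma injective_partition n (c : 'I_n -> B) :
  has_partition B n -> indexed_partition c ->
  exists c' : 'I_n -> B, [/\ injective c', indexed_partition c'
    & forall a, (hits c a <= hits c' a)%N].
Proof.
move=> Bn; have [z] := ubnP #|[set x | c x == \bot]|.
elim: z c => // z IHz c ltz pc.
have [injc|ninj] := pselect (injective c); first by exists c.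
have [l [l' [ll' cl cl']]] : exists l l', [/\ l != l', c l = \bot & c l' = \bot].
  apply: contrapT => no; apply: ninj => x y cxy; apply/eqP/negP => /negP xy.
  have := pc.1 _ _ xy; rewrite -cxy meetxx => cx; apply: no; exists x, y.
  by rewrite -cxy.
have [c1 [pc1 le1 lt1]] := split_partition Bn pc ll' cl cl'.
have [c2 [? ? le2]] := IHz _ (leq_trans lt1 ltz) pc1.
by exists c2; split=> // a; apply: leq_trans (le1 a) (le2 a).
Qed.

End IndexedPartition.

(** * Trees *)

Section Trees.
Local Open Scope classical_set_scope.
Local Open Scope card_scope.
Implicit Types (T : set (seq nat)) (s t u : seq nat).

Lemma card_successorsP n T s :
  immediate_successors T s #= `I_n <->
  exists e : 'I_n -> nat,
    injective e /\ forall y, T (rcons s y) <-> exists x, y = e x.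
Proof.
split=> [/card_set_bijP[f [fI injf surjf]]|[e [inje eP]]].
  have /choice[e eP] (x : 'I_n) :
      exists y, T (rcons s y) /\ f (rcons s y) = x.
    by have [t [Tt [y Et]] ft] := surjf x (ltn_ord x); exists y; rewrite -Et.
  exists e; split=> [x x' exx'|y].
    by apply: val_inj; rewrite /= -(eP x).2 -(eP x').2 exx'.
  split=> [Ty|[x ->]]; last exact: (eP x).1.
  have sy : immediate_successors T s (rcons s y) by split=> //; exists y.
  exists (Ordinal (fI _ sy)); apply: (@rcons_injr _ s).
  apply: injf; rewrite ?inE //; last by rewrite (eP _).2.
  by split; [exact: (eP _).1|exists (e (Ordinal (fI _ sy)))].
have -> : immediate_successors T s =
          (fun x => rcons s (e x)) @` [set: 'I_n].
  apply/seteqP; split=> [_ [/[swap] -[y ->] /eP[x ->]]|_ [x _ <-]]; first by exists x.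
  by split; [apply/eP; exists x|exists (e x)].
apply: card_eq_trans; last exact/card_esym/card_II.
by apply: inj_card_eq => x x' _ _ exx'; apply/inje/(@rcons_injr _ s).
Qed.

Lemma prefix_rconsP (u s : seq nat) y :
  prefix u (rcons s y) = (u == rcons s y) || prefix u s.
Proof.
elim: s u => [|z s IHs] [|x u]; rewrite ?prefix0s ?orbT //= eqseq_cons.
  by case: u => [|z u] /=; rewrite orbF.
by rewrite IHs andb_orr.
Qed.

Lemma prefix_diverge s t : ~~ prefix s t -> ~~ prefix t s ->
  exists u y z, [/\ y != z, prefix (rcons u y) s & prefix (rcons u z) t].
Proof.
elim: s t => [|y s IHs] [|z t] //=; have [<-{z}|yz _ _] := eqVneq y z; last first.
  by exists [::], y, z; rewrite /= !eqxx !prefix0s.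
move=> /IHs/[apply] -[u [x [z [xz us ut]]]].
by exists (y :: u), x, z; rewrite /= eqxx.
Qed.

Lemma finite_tree_bounded T : finite_set T ->
  exists N, forall s, T s -> (size s <= N)%N.
Proof.
move=> /finite_seqP[r ->]; exists (\max_(s <- r) size s) => s /= sr.
by rewrite leq_bigmax_seq.
Qed.

Lemma tree_nil T : is_tree T -> T [::].
Proof. by move=> [[s Ts] closedT]; apply: closedT Ts _; rewrite prefix0s. Qed.

Lemma not_mu_rcons T s y : T (rcons s y) -> ~ mu T s.
Proof.
move=> Tsy [_ /(_ _ Tsy (prefix_rcons _ _))] /(congr1 size)/eqP.
by rewrite size_rcons eqn_leq ltnn.
Qed.

End Trees.

(** * Complete trees of finite height *)

Section FullTree.
Local Open Scope classical_set_scope.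
Local Open Scope card_scope.
Variables (i p : nat).
Hypothesis i0 : (0 < i)%N.

Definition full_tree : set (seq nat) :=
  [set t | (size t <= p)%N /\ all (gtn i) t].

Lemma full_tree_rcons t y :
  full_tree (rcons t y) <-> [/\ full_tree t, (size t < p)%N & (y < i)%N].
Proof.
rewrite /full_tree /= size_rcons all_rcons; split=> [[lt_p /andP[yi ti]]|].
  by split=> //; split=> //; exact: ltnW.
by move=> [[_ ti] lt_p yi]; split=> //; apply/andP.
Qed.

Lemma full_tree_is_tree : is_tree (full_tree).
Proof.
split; first by exists [::].
move=> s t [tp ti] /prefixP[u tE]; move: tp ti; rewrite tE size_cat all_cat.
by move=> tp /andP[? _]; split=> //; apply: leq_trans tp; exact: leq_addr.
Qed.

Lemma mu_full_tree t : mu (full_tree) t <-> full_tree t /\ size t = p.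
Proof.
split=> [Mt|[Tt tp]]; last first.
  split=> // u [up _] /prefixP[v uE]; move: up.
  by rewrite uE size_cat tp -{2}[p]addn0 leq_add2l leqn0 => /nilP ->; rewrite cats0.
split; first exact: Mt.1.
apply/eqP; rewrite eqn_leq Mt.1.1 leqNgt; apply/negP => lt_p.
have T0 : full_tree (rcons t (Ordinal i0)).
  by apply/full_tree_rcons; split=> //; exact: Mt.1.
exact: not_mu_rcons T0 Mt.
Qed.

Lemma full_tree_finite : finite_set (full_tree).
Proof.
apply: (@sub_finite_set _ _ ((fun b : p.-bseq 'I_i => map val b) @` setT)); last first.
  exact/finite_image/finite_finset.
move=> t [tp ti].
have st : (size [seq insubd (Ordinal i0) y | y <- t] <= p)%N by rewrite size_map.
exists (Bseq st) => //=; rewrite -map_comp -[RHS]map_id; apply/eq_in_map => y yt /=.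
by rewrite val_insubd; have /= -> := allP ti _ yt.
Qed.

Lemma full_tree_branching : branching i (full_tree).
Proof.
move=> t Tt Nt; apply/card_successorsP; exists val; split; first exact: val_inj.
move=> y; rewrite full_tree_rcons; split=> [[_ _ yi]|[x ->]].
  by exists (Ordinal yi).
split=> //; last exact: ltn_ord.
rewrite ltn_neqAle Tt.1 andbT; apply/eqP => tp.
by apply: Nt; apply/mu_full_tree.
Qed.

End FullTree.

(** * From reaping numbers to trees *)

Section TreeOfPartitions.
Context {d : Order.disp_t} {B : ctbDistrLatticeType d}.
Variables (i k : nat) (T : set (seq nat)).
Variables (label : seq nat -> 'I_i -> nat) (rho : B -> 'I_i -> B).
Hypothesis T_tree : is_tree T.
Hypothesis T_finite : finite_set T.
Hypothesis label_inj : forall s, T s -> ~ mu T s -> injective (label s).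
Hypothesis labelP : forall s, T s -> ~ mu T s ->
  forall y, T (rcons s y) <-> exists x, y = label s x.
Hypothesis rhoP : forall b, indexed_partition (rho b).
Local Open Scope order_scope.

(* The children of a node that carries [b] carry the meets of [b] with the pieces
   of [rho b]; [label s] lists the children of [s]. *)
Definition extend_node (p : seq nat * B) (y : nat) : seq nat * B :=
  (rcons p.1 y, p.2 `&` \join_(x < i | label p.1 x == y) rho p.2 x).

(** The fold also carries the prefix read so far, because [label] depends on it. *)
Definition node (s : seq nat) : B := (foldl extend_node ([::], \top) s).2.

Lemma node_rcons s y :
  node (rcons s y) = node s `&` \join_(x < i | label s x == y) rho (node s) x.
Proof.
rewrite /node foldl_rcons /=; suff -> : (foldl extend_node ([::], \top) s).1 = s.
  by [].
by elim/last_ind: s => //= s z IHs; rewrite foldl_rcons /= IHs.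
Qed.

Lemma node_label s x : T s -> ~ mu T s ->
  node (rcons s (label s x)) = node s `&` rho (node s) x.
Proof.
move=> Ts Ns; rewrite node_rcons (big_pred1 x) // => z.
by rewrite /= (inj_eq (label_inj Ts Ns)).
Qed.

Lemma node_prefix s t : prefix s t -> node t <= node s.
Proof.
elim/last_ind: t => [|t y IHt]; first by rewrite prefixs0 => /eqP ->.
rewrite prefix_rconsP => /predU1P[-> //|/IHt]; apply: le_trans.
by rewrite node_rcons leIl.
Qed.

Lemma node_siblings s y z : T (rcons s y) -> T (rcons s z) -> y != z ->
  node (rcons s y) `&` node (rcons s z) = \bot.
Proof.
move=> Ty Tz yz; have Ns := not_mu_rcons Ty.
have Ts : T s by apply: T_tree.2 Ty _; exact: prefix_rcons.
have [x yE] := (labelP Ts Ns y).1 Ty; have [x' zE] := (labelP Ts Ns z).1 Tz.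
subst y z; rewrite !node_label // meetACA (rhoP _).1 ?meetx0 //.
by apply: contraNneq yz => ->.
Qed.

Lemma node_leaves s t : mu T s -> mu T t -> s != t ->
  node s `&` node t = \bot.
Proof.
move=> Ms Mt st.
have [||u [y [z [yz us ut]]]] := @prefix_diverge s t.
- by apply: contraNN st => /(Ms.2 _ Mt.1) ->.
- by apply: contraNN st => /(Mt.2 _ Ms.1) ->.
apply/eqP; rewrite -lex0.
rewrite -(@node_siblings u y z) ?leI2 ?node_prefix //.
  exact: T_tree.2 Ms.1 us.
exact: T_tree.2 Mt.1 ut.
Qed.

(** The pieces of [rho (node s)] cover, so a node that meets [a] has a child that meets [a]; bounded
    height makes this descent end at a leaf. *)
Lemma node_leaf_meets s a : T s -> node s `&` a != \bot ->
  exists t, mu T t /\ node t `&` a != \bot.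
Proof.
have [N TN] := finite_tree_bounded T_finite.
have [w] := ubnP (N - size s)%N; elim: w s => // w IHw s lew Ts sa.
have [Ms|Ns] := pselect (mu T s); first by exists s.
have [x xsa] := (rhoP (node s)).2 _ sa.
have Tsx : T (rcons s (label s x)) by apply/labelP => //; exists x.
apply: (IHw (rcons s (label s x))) => //; last first.
  by rewrite node_label // [_ `&` rho _ _]meetC -meetA.
have := TN _ Tsx; rewrite size_rcons => ltN.
by rewrite -ltnS; apply: leq_trans lew; rewrite ltnS ltn_sub2l.
Qed.

Lemma leaves_partition j (chi : seq nat -> nat) :
  (forall s, mu T s -> (chi s < j)%N) ->
  exists c : 'I_j -> B, indexed_partition c /\
    forall l a, c l `&` a != \bot <->
      exists s, [/\ mu T s, chi s = l & node s `&` a != \bot].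
Proof.
move=> chij; have /finite_seqP[r TE] := T_finite.
pose c (l : 'I_j) := \join_(s <- r | `[< mu T s >] && (chi s == l)) node s.
have cP l a : c l `&` a != \bot <->
    exists s, [/\ mu T s, chi s = l & node s `&` a != \bot].
  rewrite joins_meet_neq0; split=> [/hasP[s _ /andP[/andP[/asboolP Ms /eqP sl] sa]]|].
    by exists s.
  move=> [s [Ms sl sa]]; apply/hasP; exists s; last by rewrite sl eqxx sa asboolT.
  by have := Ms.1; rewrite TE.
exists c; split=> //; split=> [l l' ll'|a a0].
  apply/eqP/negP => /negP /cP[s [Ms sl]]; rewrite meetC => /cP[t [Mt tl]].
  apply/negP; rewrite negbK node_leaves //.
  by apply: contraNneq ll' => ts; apply/eqP/val_inj; rewrite /= -sl -tl ts.
have [|s [Ms sa]] := @node_leaf_meets [::] a (tree_nil T_tree).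
  by rewrite /node /= meet1x.
by exists (Ordinal (chij _ Ms)); apply/cP; exists s.
Qed.

(** A node that meets [a] has at least [k] children that meet [a]; [g] selects [k] of them, and [T']
    consists of the nodes reached by these selections alone. *)
Lemma branching_selection a : (0 < k)%N -> a != \bot ->
  (forall b, b `&` a != \bot -> (k <= hits (rho b) (b `&` a))%N) ->
  exists T', [/\ is_tree T', (T' `<=` T)%classic, branching k T',
    (mu T' `<=` mu T)%classic & forall s, T' s -> node s `&` a != \bot].
Proof.
move=> k0 a0 rho_a.
have /choice[g gP] s : exists g : 'I_k -> nat,
    T s -> ~ mu T s -> node s `&` a != \bot -> injective g /\
    forall x, T (rcons s (g x)) /\ node (rcons s (g x)) `&` a != \bot.
  have [[[Ts Ns] sa]|no] := pselect ((T s /\ ~ mu T s) /\ node s `&` a != \bot);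
    last by exists (fun=> 0%N) => ? ? ?; case: no.
  pose h x := enum_val (widen_ord (rho_a _ sa) x).
  exists (label s \o h) => _ _ _; split=> [|x] /=.
    apply: inj_comp (label_inj Ts Ns) _ => x y /enum_val_inj /(congr1 val) /= xy.
    exact: val_inj.
  split; first by apply/labelP => //; exists (h x).
  have := enum_valP (widen_ord (rho_a _ sa) x); rewrite inE -/(h x).
  by rewrite node_label // meetCA meetA.
pose T' s := T s /\ forall u y, prefix (rcons u y) s -> exists x, y = g u x.
have T'T s : T' s -> T s by case.
have T'a s : T' s -> node s `&` a != \bot.
  elim/last_ind: s => [|s y IHs] [Tsy gs]; first by rewrite /node /= meet1x.
  have Ts : T s by apply: T_tree.2 Tsy _; exact: prefix_rcons.
  have sa : node s `&` a != \bot.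
    apply: IHs; split=> // u z us; apply: gs.
    by apply: prefix_trans us _; exact: prefix_rcons.
  have [x ->] := gs _ _ (prefix_refl _).
  exact: ((gP _ Ts (not_mu_rcons Tsy) sa).2 x).2.
have T'_tree : is_tree T'.
  split; first by exists [::]; split=> [|[] //]; exact: tree_nil.
  move=> s t [Tt gt] st; split; first exact: T_tree.2 Tt st.
  by move=> u y us; apply: gt; exact: prefix_trans us st.
have T'g s x : T' s -> ~ mu T s -> T' (rcons s (g s x)).
  move=> T's Ns; split; first exact: ((gP _ (T'T _ T's) Ns (T'a _ T's)).2 x).1.
  move=> u y; rewrite prefix_rconsP => /predU1P[/rcons_inj[-> ->]|]; first by exists x.
  exact: T's.2.
exists T'; split=> //; last first.
(* As [k] is positive, a node of [T'] that is not a leaf of [T] has a child in [T']. *)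
- move=> s [T's max_s]; apply: contrapT => Ns.
  have Ns' : ~ mu T s by [].
  have T'x := T'g _ (Ordinal k0) T's Ns'.
  by apply: (not_mu_rcons T'x); split.
- move=> s T's Ns'; apply/card_successorsP.
  have Ns : ~ mu T s.
    by move=> Ms; apply: Ns'; split=> // t /T'T; exact: Ms.2.
  exists (g s); split; first exact: (gP _ (T'T _ T's) Ns (T'a _ T's)).1.
  move=> y; split=> [T'y|[x ->]]; last exact: T'g.
  exact: T'y.2 (prefix_refl _).
Qed.

End TreeOfPartitions.

(** * Strict inequality implies the tree property *)

Section Necessity.
Local Open Scope classical_set_scope.
Local Open Scope card_scope.

(** A set no larger than [A] that no partition [(i,k)]-reaps would bound the larger reaping number
    by the size of [A]. *)
Lemma reaping_number_ltP d (B : ctbDistrLatticeType d) j m i k :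
  reaping_number_lt B j m i k -> exists A : set B, unreaped j m A /\
    forall D : set B, ~ D \bot%O -> D #<= A -> exists R, reaped_by i k R D.
Proof.
move=> [[A|] [c' [+ c'P ltAc']]] //= => -[unA _]; exists A; split=> // D D0 DA.
apply: contrapT => noR; have unD : unreaped i k D.
  by split=> // R RD; apply: noR; exists R.
case: c' => [C|] in c'P ltAc'; last exact: c'P unD.
by apply: ltAc'.2; apply: card_le_trans DA; exact: c'P.2.
Qed.

Lemma card_finset_le (I : finType) (S : {set I}) n :
  ([set` S] #<= `I_n) = (#|S| <= n)%N.
Proof.
rewrite -card_le_II; apply: card_le_eql.
have /card_eq_fsetP : #|` [fset x in S]%fset| = #|S| by rewrite card_finset.
by congr (_ #= _); apply/seteqP; split=> x /=; rewrite !inE.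
Qed.

(* Repartitioning [b] separately for every [b] only ever reaps the traces on [b]
   of members of [A], hence sets that are no larger than [A]. *)
Lemma tree_property_of_reaping d (B : ctbDistrLatticeType d) i j k m :
  (0 < k)%N -> (0 < m)%N -> has_partition B j ->
  reaping_number_lt B j m i k -> tree_property i j k m.-1.
Proof.
move=> k0 m0 Bj /reaping_number_ltP[A [[A0 unA] reapA]].
move=> T T_tree T_fin T_br chi chij.
have /choice[label label_spec] s : exists e : 'I_i -> nat,
    T s -> ~ mu T s ->
    injective e /\ forall y, T (rcons s y) <-> exists x, y = e x.
  have [[Ts Ns]|no] := pselect (T s /\ ~ mu T s); last first.
    by exists (fun=> 0%N) => ? ?; case: no.
  by have /card_successorsP[e eP] := T_br s Ts Ns; exists e.
have label_inj s Ts Ns := (label_spec s Ts Ns).1.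
have labelP s Ts Ns := (label_spec s Ts Ns).2.
have /choice[rho rho_spec] (b : B) : exists r : 'I_i -> B,
    indexed_partition r /\
    forall a, A a -> (b `&` a)%O != \bot%O -> (k <= hits r (b `&` a)%O)%N.
  pose D := [set x | x != \bot%O] `&` (fun a => (b `&` a)%O) @` A.
  have [||R RD] := reapA D.
  - by move=> [/negP]; rewrite eqxx.
  - apply: card_le_trans (card_image_le (fun a => (b `&` a)%O) A).
    exact: subset_card_le (@subIsetr _ _ _).
  have [r [_ rP rD]] := (reaped_byP i k D).1 (ex_intro _ R RD).
  by exists r; split=> // a Aa ba; apply: rD; split=> //; exists a.
have rhoP b := (rho_spec b).1.
have [c [cpart cP]] := leaves_partition T_tree T_fin label_inj labelP rhoP chij.
have [c' [injc' c'part lec']] := injective_partition Bj cpart.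
have [a Aa lta] : exists2 a, A a & (hits c' a < m)%N.
  apply: contrapT => no.
  have [R RA] : exists R, reaped_by j m R A.
    apply/reaped_byP; exists c'; split=> // a Aa.
    by rewrite leqNgt; apply/negP => lta; apply: no; exists a.
  exact: unA RA.
have a0 : a != \bot%O by apply/eqP => aE; apply: A0; rewrite -aE.
have [T' [T'_tree T'T T'_br T'mu T'a]] :=
  branching_selection T_tree label_inj labelP k0 a0
    (fun b => (rho_spec b).2 a Aa).
exists T'; split=> //.
(* All leaves of [T'] meet [a], so their colours index pieces of [c] that meet [a], and there are
   fewer than [m] of these. *)
apply: (@card_le_trans _ _ _ [set` [set l | (c l `&` a)%O != \bot%O]%SET]).
  apply: card_le_trans (card_image_le (@nat_of_ord j) _).
  apply: subset_card_le => _ [s Ms <-]; exists (Ordinal (chij _ (T'mu _ Ms))) => //=.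
  by rewrite inE; apply/cP; exists s; split; [exact: T'mu| |exact: T'a Ms.1].
rewrite card_finset_le -ltnS prednK //.
exact: leq_ltn_trans (lec' a) lta.
Qed.

End Necessity.

(** * Cardinals *)

Section Cardinals.
Local Open Scope classical_set_scope.
Local Open Scope card_scope.

(* A maximal set of choice functions on the family [P] which differ pairwise at
   every member must exhaust some member of [P]; that member then injects into
   all the others. *)
Lemma exists_least_card (T : Type) (P : set (set T)) : P !=set0 ->
  exists A, P A /\ forall C, P C -> A #<= C.
Proof.
move=> [C0 PC0]; pose I := {C : set T | P C}.
pose Q (G : set (I -> T)) := (forall f, G f -> forall s, sval s (f s)) /\
  forall f g s, G f -> G g -> f s = g s -> f = g.
have [F FQ Ftot|G [[GI Ginj] Gmax]] := @Zorn_bigcup (I -> T) Q.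
  split=> [f [X FX Xf] s|f g s [X FX Xf] [Y FY Yg]]; first exact: (FQ X FX).1.
  have [XY|YX] := Ftot _ _ FX FY.
    exact: (FQ Y FY).2 (XY _ Xf) Yg.
  exact: (FQ X FX).2 Xf (YX _ Yg).
(* Otherwise some choice function [h] differs at every index from all members of [G], and adding it
   contradicts maximality. *)
have [s sG] : exists s : I, forall x, sval s x -> exists2 f, G f & f s = x.
  apply: contrapT => noS.
  have /choice[h hP] (s : I) :
      exists x, sval s x /\ forall f, G f -> f s <> x.
    apply: contrapT => nox; apply: noS; exists s => x sx.
    apply: contrapT => nof; apply: nox; exists x; split=> // f Gf fx.
    by apply: nof; exists f.
  apply: (Gmax (G `|` [set h])).
    split; first by move=> f; left.
    move=> /(_ h (or_intror erefl)) Gh.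
    exact: (hP (exist _ C0 PC0)).2 Gh erefl.
  split=> [f [/GI //|-> s]|f g s [Gf|->] [Gg|->] fg] //.
  - exact: (hP s).1.
  - exact: Ginj fg.
  - by case: ((hP s).2 f Gf).
  - by case: ((hP s).2 g Gg).
exists (sval s); split=> [|C PC]; first exact: (svalP s).
apply: (@card_le_trans _ _ _ G).
  apply: card_le_trans (card_image_le (fun f => f s) G).
  by apply: subset_card_le => x /sG[f Gf <-]; exists f.
pose t : I := exist _ C PC.
have : (fun f => f t) @` G #= G.
  by apply: inj_card_eq => f g /set_mem Gf /set_mem Gg; apply: Ginj.
rewrite card_eq_sym card_eq_le => /andP[le _]; apply: card_le_trans le _.
by apply: subset_card_le => _ [f Gf <-]; exact: GI f Gf t.
Qed.

Lemma uncountable_nat_bool : ~ countable [set: nat -> bool].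
Proof.
move=> /countable_injP[f injf].
pose x n := ~~ `[< exists2 y, f y = n & y n >].
have : x (f x) = ~~ x (f x); last by case: (x _).
rewrite {1}/x; congr (~~ _); apply/idP/idP => [/asboolP[y fyx yx]|xfx].
  by have xy : y = x; [apply: injf; rewrite ?inE|rewrite -{1}xy].
by apply/asboolP; exists x.
Qed.

Lemma countableU (T : Type) (A C : set T) :
  countable A -> countable C -> countable (A `|` C).
Proof.
move=> cA cC.
have : countable (\bigcup_(b in [set: bool]) (if b then A else C)).
  by apply: bigcup_countable => // -[].
apply: sub_countable; apply: subset_card_le => x [Ax|Cx]; first by exists true.
by exists false.
Qed.

Lemma well_order_min (U : Type) (R : rel U) (A : set U) :
  well_order R -> A !=set0 -> exists2 z, A z & forall x, A x -> R z x.
Proof.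
move=> R_wo [x Ax]; have [|z [[zA minz] _]] := R_wo (fun x => `[< A x >]).
  by exists x; apply/asboolP.
exists z; first exact/asboolP.
by move=> y Ay; apply: minz; apply/asboolP.
Qed.

(* [L] is an uncountable set of 0-1 sequences, well ordered so that all initial
   segments are countable; [below x] enumerates the segment of [x]. *)
Lemma omega1_exists :
  exists (L : choiceType) (lt : rel L) (tag : L -> nat -> bool)
      (below : L -> nat -> L),
    [/\ well_founded lt, irreflexive lt, transitive lt
      & forall x y, x != y -> lt x y || lt y x] /\
    [/\ injective tag, forall x y, lt y x -> exists n, below x n = y
      & forall A : set L, countable A -> exists x, forall y, A y -> lt y x].
Proof.
have [R R_wo] := well_ordering_principle (nat -> bool).
have wo : wo_chain R predT by move=> A _; exact: R_wo.
have Rtotal x y : R x y || R y x by exact: wo_chainW wo _ _ _ _.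
have Ranti x y : R x y -> R y x -> x = y.
  by move=> xy yx; apply: (wo_chain_antisymmetric wo); rewrite ?xy.
have Rtrans : transitive R.
  move=> y x z xy yz.
  have [|t tE mint] := well_order_min (A := [set x; y; z]) R_wo.
    by exists x; left; left.
  have [tx ty tz] : [/\ R t x, R t y & R t z].
    by split; apply: mint; [left; left|left; right|right].
  case: tE tx ty tz => [[->|->]|->] // ? ? ?.
    by rewrite (Ranti x y).
  by rewrite (Ranti z y) // (Ranti y x).
pose lt x y := (x != y) && R x y.
pose seg x := [set y | lt y x].
(* If some initial segment is uncountable, the segment below the least such point serves; otherwise
   the whole order does. *)
have [P [P_unc P_seg]] : exists P : pred (nat -> bool),
    ~ countable [set x | P x] /\ forall x, P x -> countable (seg x).
  have [all_seg|] := pselect (forall x, countable (seg x)).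
    exists predT; split=> // cT; apply: uncountable_nat_bool.
    by apply: sub_countable cT; apply: subset_card_le.
  move=> /existsNP/(well_order_min R_wo)[z z_unc minz].
  exists (fun x => lt x z); split=> // x /andP[xz Rxz].
  apply: contrapT => /minz Rzx; move/eqP: xz; apply; exact: Ranti.
pose L : choiceType := {x : nat -> bool | P x}.
pose ltL (x y : L) := lt (val x) (val y).
have below_ex (x : L) : exists g : nat -> L, forall y, ltL y x -> exists n, g n = y.
  have /countable_injP[f injf] := P_seg _ (valP x).
  have /choice[g gP] n : exists y : L, forall z, ltL z x -> f (val z) = n -> y = z.
    have [[y [yx fy]]|no] := pselect (exists y, ltL y x /\ f (val y) = n).
      exists y => z zx fz; apply: val_inj; apply: injf; rewrite ?inE //.
      by rewrite fy fz.
    by exists x => z zx fz; case: no; exists z.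
  by exists g => y yx; exists (f (val y)); exact: gP yx erefl.
have /choice[below belowP] := below_ex.
exists L, ltL, val, below; split; split.
- move=> x; apply: contrapT => NAx.
  have [|z] := @well_order_min _ _ [set y | exists2 u : L, ~ Acc ltL u & val u = y] R_wo.
    by exists (val x), x.
  move=> [u Nu <-] minz; apply: Nu; constructor=> y /andP[yu Ryu].
  apply: contrapT => Ny; move/eqP: yu; apply; apply: Ranti => //.
  by apply: minz; exists y.
- by move=> x; rewrite /ltL /lt eqxx.
- move=> y x z /andP[xy Rxy] /andP[yz Ryz]; rewrite /ltL /lt (Rtrans _ _ _ Rxy) //.
  rewrite andbT; apply: contraNneq xy => xz; rewrite xz in Rxy *.
  by apply/eqP/Ranti.
- by move=> x y xy; rewrite /ltL /lt [val y == _]eq_sym (inj_eq val_inj) xy Rtotal.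
- exact: val_inj.
- exact: belowP.
(* Without a bound, [P] would be covered by the countable segments up to the members of [A]. *)
move=> A cA; apply: contrapT => nobound; apply: P_unc.
have cU : countable (\bigcup_(y in val @` A) (seg y `|` [set y])).
  apply: bigcup_countable; first exact: sub_countable (card_image_le _ _) cA.
  by move=> _ [y _ <-]; apply: countableU; [exact: P_seg (valP y)|exact: countable1].
apply: sub_countable cU; apply: subset_card_le => x Px.
apply: contrapT => xU; apply: nobound; exists (exist _ x Px) => y Ay.
have xUy : ~ (seg (val y) `|` [set val y]) x.
  by move=> ?; apply: xU; exists (val y) => //; exists y.
have yx : val y != x by apply/eqP => yx; apply: xUy; right; rewrite /= yx.
rewrite /ltL /lt /= yx /=; have /orP[//|Rxy] := Rtotal (val y) x.
by case: xUy; left; rewrite /seg /= /lt eq_sym yx.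
Qed.

End Cardinals.

(** * The algebra *)

(** [Fix] supplies values only below [b]; [ext] completes them by [v0] to a total function, and
    locality of [H] makes the completion harmless. *)
Lemma rec_exists (L V : Type) (v0 : V) (lt : rel L) (H : L -> (L -> V) -> V) :
  well_founded lt ->
  (forall b f g, (forall a, lt a b -> f a = g a) -> H b f = H b g) ->
  exists f, forall b, f b = H b f.
Proof.
move=> lt_wf H_local.
pose ext b (rec : forall a, lt a b -> V) a :=
  if pselect (lt a b) is left ab then rec a ab else v0.
pose F := Fix lt_wf (fun=> V) (fun b rec => H b (ext b rec)).
exists F => b; rewrite /F Fix_eq => [|a f g fg].
  by apply: H_local => a ab; rewrite /ext; case: pselect.
by apply: H_local => c ca; rewrite /ext; case: pselect.
Qed.

Section Model.
Local Open Scope classical_set_scope.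
Variables (i k : nat).
Variables (L : choiceType) (lt : rel L).
Variables (bits : L -> nat -> bool) (below : L -> nat -> L).

Definition kset : finType := {K : {set 'I_i} | #|K| == k}.

(* A code [((p, q); D)] allows a branch [f] to take at [b] the values in a
   [k]-set computed by [D] from the first [p] bits of [b] and the values of [f]
   at those of the first [q] elements listed by [below b] that precede [b]. *)
Definition code : countType :=
  {p : (nat * nat)%type &
    {ffun p.1.-tuple bool * p.2.-tuple (option 'I_i) -> kset}}.

Definition view (b : L) (f : L -> 'I_i) (n : nat) : option 'I_i :=
  if lt (below b n) b then Some (f (below b n)) else None.

Definition choices (z : code) (b : L) (f : L -> 'I_i) : {set 'I_i} :=
  val (tagged z ([tuple bits b n | n < (tag z).1],
                 [tuple view b f n | n < (tag z).2])).

(** The second component indexes infinitely many copies of each code; a definable set cannot tell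
    codes apart on copies of sufficiently large index. *)
Definition allowed (z : code * nat) (f : L -> 'I_i) : Prop :=
  forall b, f b \in choices z.1 b f.

Definition point := {p : (code * nat) * (L -> 'I_i) | allowed p.1 p.2}.

(* The algebra of the sets that only depend on finitely many coordinates of a
   branch and, apart from finitely many second components of [code * nat], not on
   the code. *)
Definition indist (F : seq L) (N : nat) (p q : point) : Prop :=
  (forall b, b \in F -> (sval p).2 b = (sval q).2 b) /\
  ((sval p).1 = (sval q).1 \/ (N <= (sval p).1.2)%N /\ (N <= (sval q).1.2)%N).

Definition supported (F : seq L) (N : nat) (Y : set point) : Prop :=
  forall p q, indist F N p q -> Y p -> Y q.

Lemma indist_sym F N p q : indist F N p q -> indist F N q p.
Proof.
move=> [eqF eqN]; split=> [b /eqF //|].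
by case: eqN => [->|[? ?]]; [left|right].
Qed.

Lemma indist_trans F N q p r :
  indist F N p q -> indist F N q r -> indist F N p r.
Proof.
move=> [eqF eqN] [eqF' eqN']; split=> [b bF|]; first by rewrite eqF ?eqF'.
by case: eqN => [->//|[? ?]]; case: eqN' => [<-|[? ?]]; right.
Qed.

Lemma supportedW F F' N N' Y : {subset F <= F'} -> (N <= N')%N ->
  supported F N Y -> supported F' N' Y.
Proof.
move=> FF' NN' supY p q [eqF eqN]; apply: supY; split=> [b /FF'/eqF //|].
by case: eqN => [|[? ?]]; [left|right; split; exact: leq_trans NN' _].
Qed.

Definition definable : {pred set point} :=
  fun Y => `[< exists F N, supported F N Y >].

Lemma definableP Y : reflect (exists F N, supported F N Y) (Y \in definable).
Proof. exact: asboolP. Qed.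

Lemma supported_eq F N Y p q : supported F N Y -> indist F N p q -> Y p = Y q.
Proof.
by move=> supY pq; apply/propext; split; apply: supY => //; exact: indist_sym.
Qed.

Lemma definable2 (op : Prop -> Prop -> Prop) Y Y' :
  Y \in definable -> Y' \in definable ->
  (fun p => op (Y p) (Y' p)) \in definable.
Proof.
move=> /definableP[F [N supY]] /definableP[F' [N' supY']].
apply/definableP; exists (F ++ F'), (maxn N N') => p q pq.
rewrite (@supported_eq (F ++ F') (maxn N N') Y p q) //; last first.
  by apply: supportedW supY; [move=> b bF; rewrite mem_cat bF|exact: leq_maxl].
rewrite (@supported_eq (F ++ F') (maxn N N') Y' p q) //.
by apply: supportedW supY'; [move=> b bF; rewrite mem_cat bF orbT|exact: leq_maxr].
Qed.

Lemma definableI : meet_closed definable.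
Proof. by move=> Y Y' dY dY'; exact: (definable2 and). Qed.

Lemma definableU : join_closed definable.
Proof. by move=> Y Y' dY dY'; exact: (definable2 or). Qed.

Lemma definable0 : \bot%O \in definable.
Proof. by apply/definableP; exists [::], 0%N. Qed.

Lemma definable1 : \top%O \in definable.
Proof. by apply/definableP; exists [::], 0%N. Qed.

Lemma definableC Y : Y \in definable -> (~` Y) \in definable.
Proof.
move=> /definableP[F [N supY]]; apply/definableP; exists F, N => p q pq nYp Yq.
by apply: nYp; apply: supY Yq; exact: indist_sym.
Qed.

Definition algebra := {Y : set point | Y \in definable}.

HB.instance Definition _ := SubChoice.on algebra.
HB.instance Definition _ := Order.SubChoice_isTBSubLattice.Build
  set_display (set point) definable set_display algebra
  definableI definableU definable0 definable1.

Lemma algebra_meetUl : left_distributive (@Order.meet _ algebra) Order.join.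
Proof. by move=> x y z; apply: val_inj; rewrite /= meetUl. Qed.
HB.instance Definition _ :=
  Order.Lattice_Meet_isDistrLattice.Build set_display algebra algebra_meetUl.

Definition algebra_compl (Y : algebra) : algebra :=
  Sub (~` \val Y) (definableC (valP Y)).

Lemma algebra_joinC (Y : algebra) : Order.join Y (algebra_compl Y) = \top%O.
Proof. by apply: val_inj; exact: joinxC. Qed.

Lemma algebra_meetC (Y : algebra) : Order.meet Y (algebra_compl Y) = \bot%O.
Proof. by apply: val_inj; exact: meetxC. Qed.

HB.instance Definition _ := Order.TBDistrLattice_hasComplement.Build
  set_display algebra algebra_joinC algebra_meetC.

Lemma algebra_neq0P (Y : algebra) : Y != \bot%O <-> exists p, val Y p.
Proof.
split=> [/eqP Y0|[p Yp]]; last by apply/eqP => Y0; rewrite Y0 in Yp.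
apply: contrapT => noY; apply: Y0; apply: val_inj; rewrite /=.
by apply/seteqP; split=> p // Yp; apply: noY; exists p.
Qed.

Lemma algebra_meets (Y Y' : algebra) :
  Order.meet Y Y' != \bot%O <-> exists p, val Y p /\ val Y' p.
Proof. exact: algebra_neq0P. Qed.

Lemma indexed_partition_algebra n (c : 'I_n -> algebra) (f : point -> 'I_n) :
  (forall l p, val (c l) p <-> f p = l) -> (forall l, exists p, f p = l) ->
  injective c /\ indexed_partition c.
Proof.
move=> cP f_surj; split; first move=> l l' cll'.
  by have [p fp] := f_surj l; have /cP := fp; rewrite cll' => /cP <-.
split=> [l l' ll'|a /algebra_neq0P[p ap]].
  apply/eqP/negP => /negP /algebra_meets[p [/cP fp /cP fp']].
  by move/eqP: ll'; apply; rewrite -fp -fp'.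
by exists (f p); apply/algebra_meets; exists p; split=> //; apply/cP.
Qed.

Lemma indist_refl F N p : indist F N p p.
Proof. by split=> //; left. Qed.

Lemma cylinder_definable F N p : indist F N p \in definable.
Proof.
apply/definableP; exists F, N => q r qr pq; exact: indist_trans pq qr.
Qed.

Definition slice (z : code * nat) : algebra.
Proof.
(* With the bound [z.2.+1], points of the slice are indistinguishable only from points with the same
   pair [z]. *)
exists (fun p : point => (sval p).1 = z); apply/definableP; exists [::], z.2.+1.
by move=> p q [_ [<- //|[+ _]]] zp; rewrite zp ltnn.
Defined.

Definition coordinate (b : L) (x : 'I_i) : algebra.
Proof.
exists (fun p : point => (sval p).2 b = x); apply/definableP; exists [:: b], 0%N.
by move=> p q [/(_ b (mem_head _ _)) ->].
Defined.

(** Capping the second component at [n] sorts the points into [n.+1] classes, which provides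
    partitions of every positive size. *)
Definition depth_piece (n l : nat) : algebra.
Proof.
exists (fun p : point => minn (sval p).1.2 n = l); apply/definableP.
exists [::], n => p q [_ [<- //|[np nq]]].
by rewrite (minn_idPr np) (minn_idPr nq).
Defined.

(** * Extending branches and reaping countable sets *)

Hypotheses (k0 : (0 < k)%N) (ki : (k <= i)%N).
Hypotheses (lt_wf : well_founded lt) (lt_irr : irreflexive lt).
Hypotheses (lt_trans : transitive lt).
Hypothesis lt_total : forall x y, x != y -> lt x y || lt y x.
Hypothesis bits_inj : injective bits.
Hypothesis belowP : forall x y, lt y x -> exists n, below x n = y.
Hypothesis lt_bounded :
  forall A : set L, countable A -> exists x, forall y, A y -> lt y x.

Let x0 : 'I_i := Ordinal (leq_trans k0 ki).

Lemma view_local b (f g : L -> 'I_i) n :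
  (forall a, lt a b -> f a = g a) -> view b f n = view b g n.
Proof. by move=> fg; rewrite /view; case: ifP => // /fg ->. Qed.

Lemma choices_local z b (f g : L -> 'I_i) :
  (forall a, lt a b -> f a = g a) -> choices z b f = choices z b g.
Proof.
move=> fg; rewrite /choices; congr (val (tagged z (_, _))).
by apply: eq_from_tnth => n; rewrite !tnth_mktuple; exact: view_local.
Qed.

Lemma choices_inh z b f : exists x, x \in choices z b f.
Proof.
by apply/set0Pn; rewrite -card_gt0 (eqP (valP (tagged z _))).
Qed.

(** Keep [f] below [b], put [x] at [b] and choose recursively elsewhere. The choices at and below
    [b] do not change, since they depend only on earlier values. *)
Lemma allowed_extend z b f x : allowed z f -> x \in choices z.1 b f ->
  exists g, [/\ allowed z g, forall a, lt a b -> g a = f a & g b = x].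
Proof.
move=> zf xb; pose H a (g : L -> 'I_i) :=
  if lt a b then f a else if a == b then x else xchoose (choices_inh z.1 a g).
have [|g gH] := @rec_exists L 'I_i x0 lt H lt_wf.
  move=> a g g' gg'; rewrite /H; case: ifP => // _; case: ifP => // _.
  by apply: eq_xchoose => y; rewrite (choices_local _ gg').
have gf a : lt a b -> g a = f a by move=> ab; rewrite gH /H ab.
have gb : g b = x by rewrite gH /H lt_irr eqxx.
exists g; split=> // a; have [->|ab] := eqVneq a b.
  by rewrite gb (choices_local _ gf).
have [lab|nlab] := boolP (lt a b).
  rewrite gf // (@choices_local _ _ g f); first exact: zf.
  by move=> c ca; apply: gf; exact: lt_trans ca lab.
rewrite [g a]gH /H (negbTE nlab) (negbTE ab); exact: xchooseP.
Qed.

Lemma allowed_exists z : exists f, allowed z f.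
Proof.
pose H a (g : L -> 'I_i) := xchoose (choices_inh z.1 a g).
have [|f fH] := @rec_exists L 'I_i x0 lt H lt_wf.
  by move=> a g g' gg'; apply: eq_xchoose => y; rewrite (choices_local _ gg').
by exists f => b; rewrite fH; exact: xchooseP.
Qed.

Lemma kset_mem (x : 'I_i) : exists K : kset, x \in val K.
Proof.
pose K0 := [set widen_ord ki y | y : 'I_k].
have x0K0 : x0 \in K0 by apply/imsetP; exists (Ordinal k0) => //; exact: val_inj.
have cardK0 : #|K0| = k.
  by rewrite card_imset ?card_ord // => y y' /(congr1 val) ?; apply: val_inj.
have cardK : #|tperm x0 x @: K0| == k.
  by rewrite card_imset ?cardK0 //; exact: perm_inj.
exists (Sub (tperm x0 x @: K0) cardK) => /=.
by apply/imsetP; exists x0; rewrite ?tpermL.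
Qed.

Lemma coordinate_exists b x : exists p : point, (sval p).2 b = x.
Proof.
have [K xK] := kset_mem x.
(* A code that reads nothing and always permits the values in [K]. *)
pose z : code := Tagged (fun p : nat * nat =>
  {ffun p.1.-tuple bool * p.2.-tuple (option 'I_i) -> kset}) (i := (0, 0))
  [ffun=> K].
have [f zf] := allowed_exists (z, 0%N).
have [||g [zg _ gb]] := @allowed_extend (z, 0%N) b f x.
- exact: zf.
- by rewrite /choices /= ffunE.
by exists (exist _ ((z, 0%N), g) zg).
Qed.

Lemma coordinate_partition b :
  injective (coordinate b) /\ indexed_partition (coordinate b).
Proof.
by apply: (@indexed_partition_algebra _ _ (fun p => (sval p).2 b)) => //;
  exact: coordinate_exists.
Qed.

(** Countably many finite supports lie below some [b]. In a point of a member [Y], the value at [b]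
    can then be changed to each of the [k] permitted ones by [allowed_extend] without leaving
    [Y]. *)
Lemma algebra_reaped (C : set algebra) :
  countable C -> ~ C \bot%O -> exists R, reaped_by i k R C.
Proof.
move=> cC C0.
have /choice[F FP] (Y : algebra) : exists F, exists N, supported F N (val Y).
  exact/definableP/valP.
have [|b bP] := lt_bounded (A := \bigcup_(Y in C) [set a | a \in F Y]).
  by apply: bigcup_countable => // Y _; exact/finite_set_countable/finite_seq.
have [inj_b part_b] := coordinate_partition b.
apply/reaped_byP; exists (coordinate b); split=> // Y CY.
have /algebra_neq0P[[[z f] /= zf] Yp] : Y != \bot%O.
  by apply/eqP => Y0; apply: C0; rewrite -Y0.
have [N supY] := FP Y.
(* Read [k] as the number of values permitted at [b]. *)
rewrite -(eqP (valP (tagged z.1 ([tuple bits b n | n < (tag z.1).1],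
                 [tuple view b f n | n < (tag z.1).2])))).
apply/subset_leq_card/fintype.subsetP => x xb; rewrite inE.
have [g [zg gf gb]] := allowed_extend zf xb.
apply/algebra_meets; exists (exist _ (z, g) zg); split=> //.
apply: supY Yp; split=> [a aF|]; last by left.
by rewrite /= gf //; apply: bP; exists Y.
Qed.

Lemma algebra_partition n : (0 < n)%N -> has_partition algebra n.
Proof.
case: n => // n _; apply/has_partitionP; exists (fun l : 'I_n.+1 => depth_piece n l).
pose f (p : point) := @inord n (minn (sval p).1.2 n).
have fE p : f p = minn (sval p).1.2 n :> nat by rewrite inordK // ltnS geq_minr.
apply: (@indexed_partition_algebra _ _ f) => l.
  by move=> p; split=> [pl|<-]; [apply: ord_inj; rewrite fE|exact/esym/fE].
have [b _] := lt_bounded (countable0 L).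
have [[[[z N] g] zg] _] := coordinate_exists b x0.
(* Admissibility depends on the code alone, so [zg] also fits the second component [l]. *)
exists (exist _ ((z, nat_of_ord l), g) zg); apply: ord_inj; rewrite fE /=.
by apply/minn_idPl; rewrite -ltnS.
Qed.

(** * Realising finite trees by codes *)

Lemma bits_separate (s : seq L) : exists n, forall a b, a \in s -> b \in s ->
  (forall u, (u < n)%N -> bits a u = bits b u) -> a = b.
Proof.
have /choice[dif difP] (p : L * L) :
    exists u, p.1 != p.2 -> bits p.1 u != bits p.2 u.
  apply: contrapT => no; have Np u : ~ (p.1 != p.2 -> bits p.1 u != bits p.2 u).
    by move=> H; apply: no; exists u.
  have p12 : p.1 != p.2 by apply: contrapT => ?; apply: (Np 0%N).
  move/eqP: p12; apply; apply: bits_inj; apply/funext => u.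
  by apply/eqP; apply: contrapT => /negP ?; apply: (Np u).
exists (\max_(p <- [seq (a, b) | a <- s, b <- s]) dif p).+1 => a b sa sb eq_bits.
apply/eqP; apply: contrapT => /negP ab; have /eqP := difP (a, b) ab; apply.
apply: eq_bits; rewrite ltnS; apply: (@leq_bigmax_seq _ _ xpredT dif) => //.
by apply/allpairsP; exists (a, b).
Qed.

Lemma below_bounded (s : seq L) : exists n, forall a b, a \in s -> b \in s ->
  lt a b -> exists2 u, (u < n)%N & below b u = a.
Proof.
have /choice[pos posP] (p : L * L) : exists u, lt p.1 p.2 -> below p.2 u = p.1.
  have [/belowP[u up]|] := boolP (lt p.1 p.2); first by exists u.
  by exists 0%N.
exists (\max_(p <- [seq (a, b) | a <- s, b <- s]) pos p).+1 => a b sa sb ab.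
exists (pos (a, b)); last exact: (posP (a, b)).
rewrite ltnS; apply: (@leq_bigmax_seq _ _ xpredT pos) => //.
by apply/allpairsP; exists (a, b).
Qed.

(** Enough bits tell the members of [s] apart, and a long enough view recovers the values at earlier
    members, so these finite data determine the value of [psi]. *)
Lemma code_exists (s : seq L) (psi : seq nat -> kset) : sorted lt s ->
  exists z : code, forall f b, b \in s ->
    choices z b f = val (psi [seq nat_of_ord (f a) | a <- take (index b s) s]).
Proof.
move=> s_sorted; have [p pP] := bits_separate s; have [q qP] := below_bounded s.
pose T := (p.-tuple bool * q.-tuple (option 'I_i))%type.
pose data b f : T := ([tuple bits b n | n < p], [tuple view b f n | n < q]).
pose res b (f : L -> 'I_i) := psi [seq nat_of_ord (f a) | a <- take (index b s) s].
have data_inj b b' f f' : b \in s -> b' \in s -> data b f = data b' f' ->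
    res b f = res b' f'.
  move=> bs bs' dd'; have eq_bits := congr1 fst dd'; have eq_view := congr1 snd dd'.
  have bb' : b = b'.
    apply: pP => // u up; have := congr1 (fun t : p.-tuple bool => tnth t (Ordinal up)) eq_bits.
    by rewrite !tnth_mktuple.
  rewrite -bb' in eq_view *; congr psi; apply/eq_in_map => a a_take.
  have sa := mem_take a_take; have ab : lt a b.
    by apply: (sorted_ltn_index lt_trans s_sorted) => //; rewrite -in_take.
  have [u uq bu] := qP a b sa bs ab.
  have := congr1 (fun t : q.-tuple _ => tnth t (Ordinal uq)) eq_view.
  by rewrite !tnth_mktuple /view /= bu ab => -[->].
have /choice[D DP] (t : T) : exists K : kset,
    forall b f, b \in s -> data b f = t -> K = res b f.
  have [[b [f [bs bt]]]|no] := pselect (exists b f, b \in s /\ data b f = t).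
    by exists (res b f) => b' f' bs' bt'; apply: data_inj; rewrite ?bt.
  by exists (psi [::]) => b f bs bt; case: no; exists b, f.
exists (Tagged (fun p : nat * nat =>
  {ffun p.1.-tuple bool * p.2.-tuple (option 'I_i) -> kset}) (i := (p, q)) (finfun D)).
by move=> f b bs; rewrite /choices /= ffunE (DP _ b f).
Qed.

(* The pieces of a [j]-partition depend on finitely many coordinates [s], which
   they colour; a [k]-branching tree of words on [s] with few colours is realised
   by some slice, of arbitrarily large second component. *)
Lemma slices_unreaped j m : (0 < j)%N -> (0 < m)%N ->
  tree_property i j k m.-1 -> unreaped j m (slice @` setT).
Proof.
have i0 := leq_trans k0 ki; move=> j0 m0 treeP; split=> [[z _ z0]|R RA].
  have [f zf] := allowed_exists z; have : slice z != \bot%O.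
    by apply/algebra_neq0P; exists (exist _ (z, f) zf).
  by rewrite z0 eqxx.
have [c [injc [disjc coverc] cA]] := (reaped_byP j m _).1 (ex_intro _ R RA).
have /choice[F0 F0P] (l : 'I_j) :
    exists FN : seq L * nat, supported FN.1 FN.2 (val (c l)).
  by have /definableP[F [N ?]] := valP (c l); exists (F, N).
pose F := flatten [seq (F0 l).1 | l : 'I_j]; pose N := \max_l (F0 l).2.
have supc l : supported F N (val (c l)).
  apply: supportedW (F0P l) => [b bF|]; last exact: (leq_bigmax_cond l).
  by apply/flattenP; exists (F0 l).1 => //; apply/mapP; exists l; rewrite ?mem_enum.
pose le a b := (a == b) || lt a b; pose s := sort le (undup F).
have le_trans : transitive le.
  move=> b a c' /predU1P[-> //|ab] /predU1P[<-|bc]; rewrite /le ?ab ?orbT //.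
  by rewrite (lt_trans ab bc) orbT.
have le_total : total le.
  move=> a b; rewrite /le eq_sym; have [//|/lt_total] := eqVneq b a.
  by rewrite orbC.
have s_uniq : uniq s by rewrite sort_uniq undup_uniq.
have s_sorted : sorted lt s.
  have : sorted le s by exact: sort_sorted.
  move: s_uniq; rewrite uniq_pairwise !sorted_pairwise // => s_uniq s_le.
  have : pairwise [rel a b | (a != b) && le a b] s by rewrite pairwise_relI s_uniq.
  by apply: sub_pairwise => a b /=; rewrite /le; case: eqP.
have memF b : b \in F -> b \in s by rewrite mem_sort mem_undup.
pose word (f : L -> 'I_i) r : seq nat := [seq nat_of_ord (f b) | b <- r].
(* No piece separates points with second component at least [N] that spell the same word, so one
   piece contains them all. Words spelt by no such point get the default colour [Ordinal j0]. *)
have /choice[chi chiP] (t : seq nat) : exists l : 'I_j, forall p : point,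
    (N <= (sval p).1.2)%N -> word (sval p).2 s = t -> val (c l) p.
  have [[p [Np pt]]|no] := pselect (exists p : point,
      (N <= (sval p).1.2)%N /\ word (sval p).2 s = t); last first.
    by exists (Ordinal j0) => p Np pt; case: no; exists p.
  pose Y : algebra := Sub (indist F N p) (cylinder_definable F N p).
  have [|l /algebra_meets[q [cq pq]]] := coverc Y.
    by apply/algebra_neq0P; exists p; exact: indist_refl.
  exists l => p' Np' p't; apply: supc cq; apply: indist_trans (indist_sym pq) _.
  split=> [b /memF bs|]; last by right.
  apply: ord_inj; move: bs; rewrite -p't in pt; move/eq_in_map: pt; exact.
have [T' [T'_tree T'T T'_br T'mu T'chi]] := treeP _ (full_tree_is_tree i (size s))
  (full_tree_finite (size s) i0) (@full_tree_branching i (size s) i0)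
  (fun t => nat_of_ord (chi t)) (fun t _ => ltn_ord (chi t)).
(* At an inner node [t] of [T'], [psi t] collects the last entries of the children of [t] in
   [T']. *)
have /choice[psi psiP] (t : seq nat) : exists K : kset,
    T' t -> (size t < size s)%N -> forall x, x \in val K -> T' (rcons t (nat_of_ord x)).
  have [[T't lt_t]|no] := pselect (T' t /\ (size t < size s)%N); last first.
    by have [K _] := kset_mem x0; exists K => T't lt_t; case: no.
  have Nt : ~ mu T' t.
    by move=> /T'mu/(mu_full_tree _ i0)[_ ts]; rewrite ts ltnn in lt_t.
  have /card_successorsP[e [inje eP]] := T'_br t T't Nt.
  have T'e y : T' (rcons t (e y)) by apply/eP; exists y.
  have ei y : (e y < i)%N by have /T'T/full_tree_rcons[] := T'e y.
  have cardK : #|[set Ordinal (ei y) | y : 'I_k]| == k.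
    rewrite card_imset ?card_ord // => y y' /(congr1 val) /=; exact: inje.
  exists (Sub [set Ordinal (ei y) | y : 'I_k] cardK) => _ _ x /imsetP[y _ ->].
  exact: T'e.
have [z zP] := code_exists psi s_sorted.
have [b0 _] := lt_bounded (countable0 L).
(* The induction is on the length of an initial segment of [s]; at each step [psi] keeps the word
   inside [T']. *)
have zT' f : allowed (z, N) f -> T' (word f s).
  move=> zf; rewrite -[s]take_size.
  have : (size s <= size s)%N by [].
  elim: {-2}(size s) => [_|n IHn ltn]; first by rewrite take0; exact: tree_nil.
  have fb := zf (nth b0 s n); rewrite zP ?mem_nth // index_uniq // in fb.
  rewrite (take_nth b0) // /word map_rcons; apply: psiP fb; first exact: IHn (ltnW _).
  by rewrite size_map size_takel // ltnW.
have : (m <= hits c (slice (z, N)))%N.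
  by apply: cA; exists (z, N).
rewrite leqNgt => /negP; apply; rewrite -[m]prednK // ltnS /hits -card_finset_le.
set S := finset _.
have : (@nat_of_ord j @` [set` S] #= [set` S])%card.
  by apply: inj_card_eq => x y _ _; exact: ord_inj.
rewrite card_eq_sym card_eq_le => /andP[leS _]; apply: card_le_trans leS _.
apply: card_le_trans T'chi; apply: subset_card_le => _ [l /= lS <-].
(* A piece that meets the slice does so at a branch whose word is a leaf of [T']; disjointness of
   the pieces forces the colour of that leaf to be [l]. *)
have : l \in S by [].
rewrite inE => /algebra_meets[[[z' f] /= zf] [cp /= zE]]; subst z'.
have T'f := zT' f zf; exists (word f s).
  split=> // t /T'T; apply: ((mu_full_tree _ i0 _).2 _).2.
  by split; [exact: T'T|rewrite size_map].
congr nat_of_ord; apply/eqP/negP => /negP /disjc /eqP; apply/negP.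
apply/algebra_meets; exists (exist _ ((z, N), f) zf); split=> //.
by apply: chiP => /=.
Qed.
End Model.

(** * The tree property implies strict inequality *)

Section Sufficiency.
Local Open Scope classical_set_scope.
Local Open Scope card_scope.

(** In the full tree of height 1, the root must keep [k] of its [i] successors. *)
Lemma tree_property_le i j k m : (0 < i)%N -> (0 < j)%N ->
  tree_property i j k m -> (k <= i)%N.
Proof.
move=> i0 j0 treeP.
have [T' [T'_tree T'T T'_br T'mu _]] := treeP _ (full_tree_is_tree i 1)
  (full_tree_finite 1 i0) (@full_tree_branching i 1 i0) (fun=> 0%N) (fun _ _ => j0).
have N0 : ~ mu T' [::] by move=> /T'mu/(mu_full_tree _ i0)[].
have /card_successorsP[e [inje eP]] := T'_br _ (tree_nil T'_tree) N0.
have ei y : (e y < i)%N.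
  by have /T'T/full_tree_rcons[] := (eP (e y)).2 (ex_intro _ y erefl).
rewrite -[k]card_ord -[i]card_ord; apply: (@leq_card _ _ (fun y => Ordinal (ei y))).
by move=> y y' /(congr1 val); apply: inje.
Qed.

Lemma is_reaping_number_exists d (B : ctbDistrLatticeType d) n k :
  exists c, is_reaping_number (B := B) n k c.
Proof.
have [[C unC]|no] := pselect (exists C : set B, unreaped n k C).
  have [|A [unA minA]] := @exists_least_card B (unreaped n k); first by exists C.
  by exists (Some A).
by exists None => C unC; apply: no; exists C.
Qed.

(** [A0] makes the first number countable; the second is uncountable or [None], since every
    countable set avoiding [\bot] is reaped. *)
Lemma reaping_number_lt_countable d (B : ctbDistrLatticeType d) n k n' k'
    (A0 : set B) :
  countable A0 -> unreaped n k A0 ->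
  (forall C : set B, countable C -> ~ C \bot%O -> exists R, reaped_by n' k' R C) ->
  reaping_number_lt B n k n' k'.
Proof.
move=> cA0 unA0 reap.
have [[A|] cP] := is_reaping_number_exists B n k; last by case: (cP A0).
have [c' c'P] := is_reaping_number_exists B n' k'.
have cA : countable A by apply: sub_countable cA0; exact: cP.2.
exists (Some A), c'; split=> //; case: c' => [C|//] in c'P *.
have ncC : ~ countable C.
  by move=> cC; have [R RC] := reap C cC c'P.1.1; exact: c'P.1.2 RC.
split; last by move=> CA; apply: ncC; exact: sub_countable CA cA.
apply: card_le_trans cA _; apply/infiniteP => finC; apply: ncC.
exact: finite_set_countable.
Qed.

Lemma reaping_of_tree_property i j k m :
  (0 < i)%N -> (0 < j)%N -> (0 < k)%N -> (0 < m)%N -> tree_property i j k m.-1 ->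
  exists (d : Order.disp_t) (B : ctbDistrLatticeType d),
    [/\ has_partition B i, has_partition B j & reaping_number_lt B j m i k].
Proof.
move=> i0 j0 k0 m0 treeP; have ki := tree_property_le i0 j0 treeP.
have [L [lt [bits [below [[wf irr trans total] [inj belowP bounded]]]]]] :=
  omega1_exists.
exists set_display, (@algebra i k L lt bits below : ctbDistrLatticeType _).
split; [exact: algebra_partition bounded _ _|exact: algebra_partition bounded _ _|].
apply: (@reaping_number_lt_countable _ _ _ _ _ _
  (@slice i k L lt bits below @` setT)).
- exact: sub_countable (card_image_le _ _) (countableP _).
- exact: slices_unreaped.
- by move=> C; apply: algebra_reaped.
Qed.

End Sufficiency.

(* The partition hypotheses ensure that both reaping numbers are meaningful:
   in an algebra with no n-partition the empty set is unreaped, r_{n,k} is 0,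
   and the equivalence fails, e.g. for i = k = m = 2, j = 3 and B = {0, 1}. *)
Theorem theorem2p3 (i j k m : nat)
    (hi : (0 < i)%N) (hj : (0 < j)%N) (hk : (0 < k)%N) (hm : (0 < m)%N) :
  tree_property i j k m.-1 <->
  exists (d : Order.disp_t) (B : ctbDistrLatticeType d),
    [/\ has_partition B i, has_partition B j & reaping_number_lt B j m i k].
Proof.
split; first exact: reaping_of_tree_property.
by move=> [d [B [_ Bj ltB]]]; exact: tree_property_of_reaping ltB.
Qed.
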